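(* The search problem Mantel is $\mathsf{PPP}$-hard; that is, every problem in $\mathsf{PPP}$ is polynomial-time reducible to Mantel.
   Context: Search problems. A search problem is a binary relation $R\subseteq\{0,1\}^*\times\{0,1\}^*$; $s$ is a solution of instance $x$ if $(x,s)\in R$. It is total if every instance has a solution. $\mathsf{TFNP}$ is the class of total search problems whose relation is decidable in deterministic polynomial time and in which every instance has a solution of length polynomial in the instance size. Problems are specified by their valid (polynomial-time recognizable) instances; for an invalid instance every string is a solution by convention. $R$ is (polynomial-time) reducible to $S$ if there are polynomial-time functions $f,g$ such that for all $x,s$: if $s$ is a solution of $f(x)$ for $S$ then $g(x,s)$ is a solution of $x$ for $R$. Pigeon: an instance is a Boolean circuit $C:\{0,1\}^n\to\{0,1\}^{n}$; a solution is either $x$ with $C(x)=0^n$ or a pair $x\ne y$ with $C(x)=C(y)$. $\mathsf{PPP}$ is the class of all $\mathsf{TFNP}$ problems reducible to Pigeon. Mantel: an instance is a Boolean circuit $C:\{0,1\}^{2n-2}\to\{0,1\}^n\times\{0,1\}^n$ ($n$ a positive integer, part of the instance); $C(i)=(u,v)$ is viewed as the edge between $u$ and $v$ in a graph with vertex set $\{0,1\}^n$. A solution is one of: (i) distinct $i,j,k$ such that the edges $C(i),C(j),C(k)$ form a triangle; (ii) $i$ such that $C(i)=(u,v)$ with $u\ge v$ in the lexicographic order; (iii) $i\ne j$ such that $C(i)=C(j)$; (iv) $i$ such that $C(i)=(u,v)$ with $v=u+1 \bmod 2^n$, where $u,v$ are regarded as integers written in binary. *)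

(* Defs.v *)
From mathcomp Require Import all_boot all_order.

Set Implicit Arguments.
Unset Strict Implicit.
Unset Printing Implicit Defensive.

Import Order.TTheory.

(** * Deterministic polynomial time *)

(** Multi-tape Turing machines over the tape alphabet [option bool], where
    [None] is the blank.  A tape [(l, r)] is two-way infinite: the head scans
    the first symbol of [r], [l] lists the cells to its left (nearest first),
    and all cells beyond the two lists are blank.  Restricting to this alphabet
    costs only a constant factor, by coding other symbols in binary. *)

Definition symbol : Type := option bool.

Inductive move := MoveL | MoveR | Stay.

Definition tape : Type := seq symbol * seq symbol.

Definition tape_read (t : tape) : symbol := head None t.2.

Definition tape_write (a : symbol) (t : tape) : tape := (t.1, a :: behead t.2).

Definition tape_move (m : move) (t : tape) : tape :=
  match m with
  | MoveL => (behead t.1, head None t.1 :: t.2)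
  | MoveR => (head None t.2 :: t.1, behead t.2)
  | Stay => t
  end.

(** A machine has [k.+2] tapes, so that two arguments always fit. *)
Record machine (k : nat) := Machine {
  state : finType;
  start : state;
  final : pred state;
  delta : state -> {ffun 'I_k.+2 -> symbol} ->
          state * {ffun 'I_k.+2 -> symbol * move}
}.

Definition config k (M : machine k) : Type :=
  state M * {ffun 'I_k.+2 -> tape}.

Definition step k (M : machine k) (c : config M) : config M :=
  if final c.1 then c else
  let: (q, act) := delta c.1 [ffun i => tape_read (c.2 i)] in
  (q, [ffun i => tape_move (act i).2 (tape_write (act i).1 (c.2 i))]).

(** The [i]-th argument is on the [i]-th tape, with the head on its first
    symbol; the remaining tapes are blank. *)
Definition init k (M : machine k) (args : seq bitseq) : config M :=
  (start M, [ffun i : 'I_k.+2 => ([::], map Some (nth [::] args i))]).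

Fixpoint bits_upto_blank (s : seq symbol) : bitseq :=
  if s is Some b :: s' then b :: bits_upto_blank s' else [::].

(** The output is read on the first tape, from the head to the next blank. *)
Definition output k (M : machine k) (c : config M) : bitseq :=
  bits_upto_blank (c.2 ord0).2.

Definition outputs_within k (M : machine k) (args : seq bitseq) (t : nat)
    (out : bitseq) : Prop :=
  let c := iter t (@step k M) (init M args) in final c.1 /\ output c = out.

Definition poly_bounded (T : nat -> nat) : Prop :=
  exists c d : nat, forall n, T n <= c * n ^ d + c.

Definition polytime1 (f : bitseq -> bitseq) : Prop :=
  exists (k : nat) (M : machine k) (T : nat -> nat), poly_bounded T /\
    forall x, outputs_within M [:: x] (T (size x)) (f x).

Definition polytime2 (g : bitseq -> bitseq -> bitseq) : Prop :=
  exists (k : nat) (M : machine k) (T : nat -> nat), poly_bounded T /\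
    forall x y, outputs_within M [:: x; y] (T (size x + size y)) (g x y).

(** * Search problems *)

Definition search_problem : Type := bitseq -> bitseq -> Prop.

Definition polytime_decidable (R : search_problem) : Prop :=
  exists chi : bitseq -> bitseq -> bool,
    polytime2 (fun x s => [:: chi x s]) /\ forall x s, R x s <-> chi x s.

Definition TFNP (R : search_problem) : Prop :=
  polytime_decidable R /\
  exists p : nat -> nat, poly_bounded p /\
    forall x, exists s, size s <= p (size x) /\ R x s.

Definition reducible (R S : search_problem) : Prop :=
  exists (f : bitseq -> bitseq) (g : bitseq -> bitseq -> bitseq),
    [/\ polytime1 f, polytime2 g & forall x s, S (f x) s -> R x (g x s)].

(** * Boolean circuits *)

(** A circuit is a straight-line program.  The argument of [GInput] is the index
    of an input bit; the arguments of [GNot], [GAnd] and [GOr] are positions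
    of earlier gates in the list. *)
Inductive gate :=
  | GInput of nat
  | GConst of bool
  | GNot of nat
  | GAnd of nat & nat
  | GOr of nat & nat.

Record circuit := Circuit {
  inputs : nat;
  gates : seq gate;
  outputs : seq nat
}.

Definition gate_wf (n j : nat) (g : gate) : bool :=
  match g with
  | GInput i => i < n
  | GConst _ => true
  | GNot a => a < j
  | GAnd a b | GOr a b => (a < j) && (b < j)
  end.

Definition circuit_wf (C : circuit) : bool :=
  all (fun j => gate_wf (inputs C) j (nth (GConst false) (gates C) j))
      (iota 0 (size (gates C)))
  && all (fun o => o < size (gates C)) (outputs C).

Definition gate_val (x vals : bitseq) (g : gate) : bool :=
  match g with
  | GInput i => nth false x i
  | GConst b => b
  | GNot a => ~~ nth false vals a
  | GAnd a b => nth false vals a && nth false vals b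
  | GOr a b => nth false vals a || nth false vals b
  end.

Definition gate_vals (C : circuit) (x : bitseq) : bitseq :=
  foldl (fun vals g => rcons vals (gate_val x vals g)) [::] (gates C).

Definition circuit_eval (C : circuit) (x : bitseq) : bitseq :=
  [seq nth false (gate_vals C x) o | o <- outputs C].

(** [C] computes a function from [{0,1}^n] to [{0,1}^m]. *)
Definition circuit_of_type (n m : nat) (C : circuit) : Prop :=
  [/\ circuit_wf C, inputs C = n & size (outputs C) = m].

(** Self-delimiting binary encoding of circuits.  Numbers are written in unary;
    as all of them are bounded by the number of inputs and gates of a
    well-formed circuit, this keeps the length polynomial in the circuit size. *)
Definition enc_nat (n : nat) : bitseq := rcons (nseq n true) false.

Definition enc_seq T (enc : T -> bitseq) (s : seq T) : bitseq :=
  rcons (flatten [seq true :: enc a | a <- s]) false.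

Definition enc_gate (g : gate) : bitseq :=
  match g with
  | GInput i => enc_nat 0 ++ enc_nat i
  | GConst b => enc_nat 1 ++ [:: b]
  | GNot a => enc_nat 2 ++ enc_nat a
  | GAnd a b => enc_nat 3 ++ enc_nat a ++ enc_nat b
  | GOr a b => enc_nat 4 ++ enc_nat a ++ enc_nat b
  end.

Definition enc_circuit (C : circuit) : bitseq :=
  enc_nat (inputs C) ++ enc_seq enc_gate (gates C) ++
  enc_seq enc_nat (outputs C).

Lemma enc_nat_cat_inj m n u v :
  enc_nat m ++ u = enc_nat n ++ v -> m = n /\ u = v.
Proof.
by elim: m n => [|m IH] [|n] //= [] // /IH [-> ->].
Qed.

Lemma enc_gate_cat_inj g h u v :
  enc_gate g ++ u = enc_gate h ++ v -> g = h /\ u = v.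
Proof.
case: g => [i|b|a|a b|a b]; case: h => [i'|b'|a'|a' b'|a' b'] //=; case.
- by move/enc_nat_cat_inj => [-> ->].
- by move=> -> ->.
- by move/enc_nat_cat_inj => [-> ->].
- by rewrite -!catA => /enc_nat_cat_inj [-> /enc_nat_cat_inj [-> ->]].
- by rewrite -!catA => /enc_nat_cat_inj [-> /enc_nat_cat_inj [-> ->]].
Qed.

Lemma enc_seq_cat_inj T (enc : T -> bitseq) :
  (forall a b u v, enc a ++ u = enc b ++ v -> a = b /\ u = v) ->
  forall s t u v, enc_seq enc s ++ u = enc_seq enc t ++ v -> s = t /\ u = v.
Proof.
move=> inj; elim=> [|a s IH] [|b t] u v //=; first by case.
rewrite /enc_seq /= !rcons_cat -!catA => -[/inj [-> E]].
by case: (IH t u v) => [|-> ->].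
Qed.

(** Hence a string is the code of at most one circuit. *)
Lemma enc_circuit_inj : injective enc_circuit.
Proof.
move=> [n gs os] [n' gs' os'] /enc_nat_cat_inj /= [-> E].
have [-> {}E] := enc_seq_cat_inj enc_gate_cat_inj E.
have [] := @enc_seq_cat_inj _ _ enc_nat_cat_inj os os' [::] [::].
  by rewrite !cats0.
by move=> ->.
Qed.

(** * Pigeon and Mantel *)

(** Both problems are quantified universally over the circuits encoded by the
    instance, so that every string solves an invalid instance.  Solutions made
    of several bit strings of the same known length are their concatenation. *)

Definition pigeon_solution (n : nat) (C : circuit) (s : bitseq) : Prop :=
  (size s = n /\ circuit_eval C s = nseq n false) \/
  (exists x y : n.-tuple bool,
     [/\ s = x ++ y, x <> y & circuit_eval C x = circuit_eval C y]).

Definition Pigeon : search_problem := fun w s =>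
  forall (n : nat) (C : circuit),
    w = enc_circuit C -> circuit_of_type n n C -> pigeon_solution n C s.

(** Most significant bit first, in accordance with the lexicographic order. *)
Definition bits_to_nat (u : bitseq) : nat := foldl (fun (a : nat) (b : bool) => a.*2 + b) 0 u.

Definition lex_ge (u v : bitseq) : bool :=
  ((v : seqlexi bool) <= (u : seqlexi bool))%O.

Definition edge (n : nat) (C : circuit) (i : bitseq) : bitseq * bitseq :=
  (take n (circuit_eval C i), drop n (circuit_eval C i)).

Definition joins (e : bitseq * bitseq) (a b : bitseq) : Prop :=
  e = (a, b) \/ e = (b, a).

Definition triangle (e1 e2 e3 : bitseq * bitseq) : Prop :=
  exists a b c, [/\ a <> b, b <> c & a <> c] /\
    [/\ joins e1 a b, joins e2 b c & joins e3 a c].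

Definition mantel_solution (n : nat) (C : circuit) (s : bitseq) : Prop :=
  let l := 2 * n - 2 in
  [\/ exists i j k : l.-tuple bool,
        [/\ s = i ++ j ++ k, [/\ i <> j, j <> k & i <> k]
          & triangle (edge n C i) (edge n C j) (edge n C k)],
      size s = l /\ lex_ge (edge n C s).1 (edge n C s).2,
      exists i j : l.-tuple bool,
        [/\ s = i ++ j, i <> j & edge n C i = edge n C j]
    | size s = l /\
      bits_to_nat (edge n C s).2 = (bits_to_nat (edge n C s).1).+1 %% 2 ^ n].

Definition Mantel : search_problem := fun w s =>
  forall (n : nat) (C : circuit), 0 < n ->
    w = enc_circuit C -> circuit_of_type (2 * n - 2) (2 * n) C ->
    mantel_solution n C s.

Definition PPP (R : search_problem) : Prop := TFNP R /\ reducible R Pigeon.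

Definition PPP_hard (S : search_problem) : Prop :=
  forall R : search_problem, PPP R -> reducible R S.

(* Main.v *)
(** Reduce Pigeon to Mantel: given [C : {0,1}^n -> {0,1}^n], let the edge with
    index [(x, y)] join [u = 0 y] to [v = 1 C(x)] in the graph on [{0,1}^(n+1)],
    where the bits of [x] and [y] are those of even and odd position in the
    index.  The graph is bipartite and [u < v], so there are no solutions of
    type (i) or (ii).  Two equal edges have the same [y] and hence are a
    collision of [C], and [v = u + 1] only if [u = 0 1...1] and [v = 1 0...0],
    i.e. [C(x) = 0].  A Pigeon solution is thus always the subsequence of even
    positions of the Mantel solution, whichever its type.

    For polynomial time, both maps are computed by finite-state transducers
    which may read their input several times and have two counters that can
    only be incremented and be written out in unary.  Such a transducer is
    simulated by one Turing machine, and the maps are composed with those of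
    the given reduction to Pigeon by a composition of machines. *)

Require Import Defs.
From HB Require Import structures.
From mathcomp Require Import all_boot all_order.
From mathcomp Require Import zify.

Set Implicit Arguments.
Unset Strict Implicit.
Unset Printing Implicit Defensive.

(** * Polynomial bounds *)

(** The base [n.+2] is at least 2, so its exponent absorbs every constant. Closure under sum,
    product and composition then becomes arithmetic on exponents. *)
Lemma poly_boundedP (T : nat -> nat) :
  poly_bounded T <-> exists e, forall n, T n <= n.+2 ^ e.
Proof.
split=> [[c [d HT]]|[e HT]].
  exists (c + d).+1 => n; apply: leq_trans (HT n) _.
  have Hc : c <= n.+2 ^ c by apply: ltnW; apply: ltn_expl.
  have Hd : n ^ d <= n.+2 ^ d.
    by case: d {HT} => // d; rewrite leq_exp2r //; lia.
  have H1 : 1 <= n.+2 ^ d by rewrite expn_gt0.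
  have := leq_mul Hc Hd; have := leq_mul Hc H1.
  by rewrite expnS expnD; nia.
(* For [n > 0] one has [n + 2 <= 3 * n]; the additive constant covers [n = 0]. *)
exists (3 ^ e), e => n; apply: leq_trans (HT n) _.
case: n => [|n].
  by apply: leq_trans (leq_addl _ _); case: e {HT} => // e; rewrite leq_exp2r.
rewrite -expnMn; apply: leq_trans (leq_addr _ _).
by case: e {HT} => // e; rewrite leq_exp2r //; lia.
Qed.

Lemma poly_bounded_le (T U : nat -> nat) :
  (forall n, T n <= U n) -> poly_bounded U -> poly_bounded T.
Proof.
move=> TU [c [d HU]]; exists c, d => n; exact: leq_trans (TU n) (HU n).
Qed.

Lemma poly_bounded_const c : poly_bounded (fun=> c).
Proof. by exists c, 0 => n; rewrite leq_addl. Qed.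

Lemma poly_bounded_id : poly_bounded id.
Proof. by exists 1, 1 => n; rewrite mul1n expn1 leq_addr. Qed.

Lemma poly_boundedM (T U : nat -> nat) :
  poly_bounded T -> poly_bounded U -> poly_bounded (fun n => T n * U n).
Proof.
move=> /poly_boundedP [a Ta] /poly_boundedP [b Ub]; apply/poly_boundedP.
by exists (a + b) => n; rewrite expnD leq_mul.
Qed.

Lemma poly_boundedD (T U : nat -> nat) :
  poly_bounded T -> poly_bounded U -> poly_bounded (fun n => T n + U n).
Proof.
move=> /poly_boundedP [a Ta] /poly_boundedP [b Ub]; apply/poly_boundedP.
exists (a + b).+1 => n; rewrite expnS expnD.
have := Ta n; have := Ub n.
have : 0 < n.+2 ^ a by rewrite expn_gt0.
have : 0 < n.+2 ^ b by rewrite expn_gt0.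
nia.
Qed.

Lemma poly_bounded_comp (T U : nat -> nat) :
  poly_bounded T -> poly_bounded U -> poly_bounded (fun n => T (U n)).
Proof.
move=> /poly_boundedP [a Ta] /poly_boundedP [b Ub]; apply/poly_boundedP.
(* [U n + 2] is at most [n.+2 ^ b + 2], hence at most [n.+2 ^ b.+2]. *)
exists (b.+2 * a) => n; apply: leq_trans (Ta _) _.
rewrite expnM; case: a {Ta} => // a; rewrite leq_exp2r // !expnS.
have := Ub n; have : 0 < n.+2 ^ b by rewrite expn_gt0.
nia.
Qed.

(** * Machines up to explicit blanks *)

Definition blank : tape := ([::], [::]).

(** A machine that writes back a scanned blank stores it explicitly, so tapes
    are compared up to such blanks. *)
Definition teq (t u : tape) : Prop :=
  nth None t.1 =1 nth None u.1 /\ nth None t.2 =1 nth None u.2.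

Lemma teq_refl t : teq t t. Proof. by []. Qed.

Lemma teq_sym t u : teq t u -> teq u t.
Proof. by case=> h1 h2; split=> i. Qed.

Lemma teq_trans u t v : teq t u -> teq u v -> teq t v.
Proof. by case=> h1 h2 [h3 h4]; split=> i; rewrite ?h1 ?h2. Qed.

Lemma teq_read t u : teq t u -> tape_read t = tape_read u.
Proof. by case=> _ /(_ 0); rewrite !nth0. Qed.

Lemma nth_None_cons (a : symbol) s u :
  nth None s =1 nth None u -> nth None (a :: s) =1 nth None (a :: u).
Proof. by move=> h [|i] /=. Qed.

Definition tape_act (a : symbol * move) (t : tape) : tape :=
  tape_move a.2 (tape_write a.1 t).

Lemma teq_act a t u : teq t u -> teq (tape_act a t) (tape_act a u).
Proof.
case: t u a => [l r] [l' r'] [a m] [/= h1 h2].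
have hr i : nth None (behead r) i = nth None (behead r') i.
  by rewrite !nth_behead h2.
have hl i : nth None (behead l) i = nth None (behead l') i.
  by rewrite !nth_behead h1.
have h0 : head None l = head None l' by rewrite -!nth0 h1.
by case: m; split=> //=; rewrite ?h0; do ?apply: nth_None_cons.
Qed.

Lemma teq_idle t : teq (tape_act (tape_read t, Stay) t) t.
Proof. by case: t => l [|a r]; split=> //= -[|i] //=; rewrite nth_nil. Qed.

Lemma teq_blanks n m : teq (nseq n None, nseq m None) blank.
Proof. by split=> i /=; rewrite nth_nseq nth_nil if_same. Qed.

Lemma bits_upto_blank_teq s u :
  nth None s =1 nth None u -> bits_upto_blank s = bits_upto_blank u.
Proof.
elim: s u => [|a s IH] [|b u] // h.
- by have := h 0; rewrite /= => <-.
- by have := h 0; rewrite /= => ->.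
have /= <- := h 0; case: a h => [a|] // h /=; congr cons.
by apply: IH => i; apply: (h i.+1).
Qed.

Lemma bits_upto_blank_map (x : bitseq) : bits_upto_blank (map Some x) = x.
Proof. by elim: x => //= a x ->. Qed.

Lemma bits_upto_blank_split s :
  exists r, nth None s =1 nth None (map Some (bits_upto_blank s) ++ None :: r).
Proof.
elim: s => [|[a|] s [r hr]] /=.
- by exists [::] => -[|i]; rewrite /= ?nth_nil.
- by exists r; apply: nth_None_cons.
- by exists s.
Qed.

Lemma size_bits_upto_blank s : size (bits_upto_blank s) <= size s.
Proof. by elim: s => [|[a|] s IH]. Qed.

(** * Timed runs up to explicit blanks *)

Section Reach.
Variables (k : nat) (M : machine k).

Definition teqs (t u : 'I_k.+2 -> tape) : Prop := forall i, teq (t i) (u i).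

Lemma step_teqs q (t u : {ffun 'I_k.+2 -> tape}) : teqs t u ->
  (step (q, t) : config M).1 = (step (q, u) : config M).1 /\
  teqs (step (q, t) : config M).2 (step (q, u) : config M).2.
Proof.
move=> tu; rewrite /step /=; case: ifP => // _.
rewrite (_ : [ffun i => tape_read (t i)] = [ffun i => tape_read (u i)]); last first.
  by apply/ffunP => i; rewrite !ffunE; apply: teq_read.
case: (delta _ _) => q' act; split=> // i; rewrite !ffunE.
exact: (@teq_act (act i)).
Qed.

Lemma iter_step_teqs n q (t u : {ffun 'I_k.+2 -> tape}) : teqs t u ->
  (iter n (@step k M) (q, t)).1 = (iter n (@step k M) (q, u)).1 /\
  teqs (iter n (@step k M) (q, t)).2 (iter n (@step k M) (q, u)).2.
Proof.
elim: n q t u => [|n IH] q t u tu; first by [].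
rewrite !iterSr; have [] := step_teqs q tu.
by case: (step _) (step _) => [q1 t1] [q2 t2] /= -> /IH; apply.
Qed.

Lemma step_final (c : config M) : final c.1 -> step c = c.
Proof. by rewrite /step => ->. Qed.

Lemma iter_step_final n (c : config M) : final c.1 -> iter n (@step k M) c = c.
Proof. by move=> h; elim: n => //= n ->; apply: step_final. Qed.

(** The time is an upper bound and the final tapes are fixed only up to [teq], so estimates can be
    rounded and tapes described by arbitrary functions. *)
Definition reach (q : state M) (t : 'I_k.+2 -> tape) (n : nat)
    (q' : state M) (t' : 'I_k.+2 -> tape) : Prop :=
  exists m u, [/\ m <= n, iter m (@step k M) (q, [ffun i => t i]) = (q', u)
                & teqs u t'].

Lemma reach_refl q t n : reach q t n q t.
Proof. by exists 0, [ffun i => t i]; split=> // i; rewrite ffunE. Qed.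

Lemma reach_teqs q t n q' t' u u' :
  teqs t u -> teqs t' u' -> reach q t n q' t' -> reach q u n q' u'.
Proof.
move=> tu tu' [m [v [mn E h]]].
have : teqs [ffun i => t i] [ffun i => u i] by move=> i; rewrite !ffunE.
move=> /(iter_step_teqs m q); rewrite E /=.
case E' : (iter m _ (q, [ffun i => u i])) => [q2 v2] [/= e h2]; subst q2.
exists m, v2; split=> // i; apply: teq_trans (tu' i).
by apply: teq_trans (h i); apply/teq_sym/h2.
Qed.

Lemma reach_trans q1 t1 q2 t2 q3 t3 m n :
  reach q1 t1 m q2 t2 -> reach q2 t2 n q3 t3 -> reach q1 t1 (m + n) q3 t3.
Proof.
move=> [m' [u [hm E h]]] [n' [v [hn E' h']]].
have : teqs [ffun i => t2 i] u by move=> i; rewrite ffunE; apply/teq_sym.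
move=> /(iter_step_teqs n' q2); rewrite E' /=.
case E2 : (iter n' _ (q2, u)) => [q4 w] [/= e h2]; subst q4.
exists (n' + m'), w; split; first by rewrite addnC leq_add.
  by rewrite iterD E E2.
by move=> i; apply: teq_trans (h' i); apply/teq_sym/h2.
Qed.

Lemma reach_leq q t m q' t' n : m <= n -> reach q t m q' t' -> reach q t n q' t'.
Proof. by move=> mn [m' [u [h1 h2 h3]]]; exists m', u; split=> //; apply: leq_trans mn. Qed.

Lemma reach_step q t q' t' (act : {ffun 'I_k.+2 -> symbol * move}) :
  ~~ final q -> delta q [ffun i => tape_read (t i)] = (q', act) ->
  (forall i, teq (tape_act (act i) (t i)) (t' i)) -> reach q t 1 q' t'.
Proof.
move=> nf E h; exists 1, [ffun i => tape_act (act i) (t i)]; split=> //=.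
  rewrite /step /= (negbTE nf).
  rewrite (_ : [ffun i => tape_read _] = [ffun i => tape_read (t i)]) ?E //.
    by congr pair; apply/ffunP => i; rewrite !ffunE.
  by apply/ffunP => i; rewrite !ffunE.
by move=> i; rewrite ffunE.
Qed.

Lemma reach_next q t q' t' (act : {ffun 'I_k.+2 -> symbol * move}) n q2 t2 :
  ~~ final q -> delta q [ffun i => tape_read (t i)] = (q', act) ->
  (forall i, teq (tape_act (act i) (t i)) (t' i)) ->
  reach q' t' n q2 t2 -> reach q t n.+1 q2 t2.
Proof.
by move=> nf E h h2; rewrite -add1n; apply: reach_trans h2; apply: reach_step E h.
Qed.

Definition runs (t : 'I_k.+2 -> tape) (n : nat) (t' : 'I_k.+2 -> tape) : Prop :=
  exists2 q, final q & reach (start M) t n q t'.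

Lemma runs_leq t m t' n : m <= n -> runs t m t' -> runs t n t'.
Proof. by move=> mn [q fq /(reach_leq mn) h]; exists q. Qed.

Lemma runs_teqs t n t' u u' :
  teqs t u -> teqs t' u' -> runs t n t' -> runs u n u'.
Proof. by move=> h1 h2 [q fq h]; exists q => //; apply: reach_teqs h. Qed.

Lemma runs_outputs args t n t' :
  runs t n t' -> teqs (init M args).2 t ->
  outputs_within M args n (bits_upto_blank (t' ord0).2).
Proof.
move=> R ht; have [q fq [m [u [mn E hu]]]] :
    runs (init M args).2 n t' by apply: runs_teqs R => // i; apply: teq_sym.
rewrite /outputs_within; have -> : init M args = (start M, [ffun i => (init M args).2 i]).
  by congr pair; apply/ffunP => i; rewrite !ffunE.
rewrite -(subnK mn) iterD E iter_step_final //=; split=> //.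
by apply: bits_upto_blank_teq; case: (hu ord0).
Qed.

(** One cell can appear by writing at the end of the right list, another by moving left past the end
    of the left list. *)
Lemma size_step (c : config M) i n :
  size (c.2 i).1 + size (c.2 i).2 <= n ->
  size ((step c).2 i).1 + size ((step c).2 i).2 <= n.+2.
Proof.
rewrite /step; case: ifP => [_|_]; first by lia.
case: (delta _ _) => q act; rewrite /= ffunE.
by case: (c.2 i) => [l r]; case: (act i) => a [] /=; rewrite ?size_behead /=; lia.
Qed.

(** The bound on [out] is what keeps intermediate results of a composition polynomially long. *)
Lemma outputs_runs args n out : outputs_within M args n out ->
  exists t', [/\ runs (init M args).2 n t', bits_upto_blank (t' ord0).2 = out
    & size out <= size (nth [::] args 0) + n.*2].
Proof.
rewrite /outputs_within; case E : (iter n _ _) => [q u] [fq ho].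
exists u; split=> //.
  exists q => //; exists n, u; split=> //; rewrite -E; congr iter.
  by congr pair; apply/ffunP => i; rewrite !ffunE.
rewrite -ho; apply: leq_trans (size_bits_upto_blank _) _.
suff : forall m, let c := iter m (@step k M) (init M args) in
  size (c.2 ord0).1 + size (c.2 ord0).2 <= size (nth [::] args 0) + m.*2.
  by move=> /(_ n) /=; rewrite E /=; lia.
elim=> [|m IH] /=; first by rewrite ffunE /= size_map addn0.
by have := size_step IH; lia.
Qed.

End Reach.

(** * Composition of machines *)

Section Seq.
Variables (k : nat) (M N : machine k).

(** Entering a final state of [M] is replaced by entering the start state of
    [N], so that the switch costs no step. *)
Definition seq_enter (q : state M) : state M + state N :=
  if final q then inr (start N) else inl q.

Definition seqM : machine k :=
  @Machine k (state M + state N)%type (seq_enter (start M))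
    (fun q => if q is inr p then final p else false)
    (fun q s => match q with
      | inl p => let: (p', a) := delta p s in (seq_enter p', a)
      | inr p => let: (p', a) := delta p s in (inr p', a)
      end).

(** [M] may halt before step [m] and idle from then on, whereas [seqM] switches to [N] at the first
    final state; hence only [m' <= m]. *)
Lemma seq_enter_iter m q t :
  final (iter m (@step k M) (q, t)).1 ->
  exists2 m', m' <= m & iter m' (@step k seqM) (seq_enter q, t) =
    (inr (start N), (iter m (@step k M) (q, t)).2).
Proof.
elim: m q t => [|m IH] q t.
  by move=> /= fq; exists 0 => //=; rewrite /seq_enter fq.
have [fq _|nfq] := boolP (final q).
  by exists 0 => //; rewrite (iter_step_final m.+1) // /seq_enter fq.
rewrite !iterSr; case E : (step (q, t)) => [q' t'] /IH [m' mm h].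
exists m'.+1 => //; rewrite iterSr -h; congr iter.
move: E; rewrite /seq_enter (negbTE nfq) /step /= (negbTE nfq).
by case: (delta q _) => q2 a [-> <-].
Qed.

Lemma seq_right_iter n p t :
  iter n (@step k seqM) (inr p, t) =
  (inr (iter n (@step k N) (p, t)).1, (iter n (@step k N) (p, t)).2).
Proof.
elim: n => //= n ->; case: (iter n _ _) => q u; rewrite /step /=.
by case: ifP => //; case: (delta _ _).
Qed.

Lemma seqM_runs t1 m t2 n t3 :
  runs M t1 m t2 -> runs N t2 n t3 -> runs seqM t1 (m + n) t3.
Proof.
move=> [q fq [m' [u [m'm E h]]]] [p fp R]; exists (inr p) => //.
have := @seq_enter_iter m' (start M) [ffun i => t1 i].
rewrite E => /(_ fq) [m2 hm2 E2].
apply: (@reach_trans _ seqM _ _ (inr (start N)) t2).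
  by exists m2, u; split=> //; apply: leq_trans hm2 _.
case: R => n' [v [hn E' hv]].
apply: (@reach_teqs _ _ _ t2 _ _ t3) => //.
exists n', v; split=> //; first by rewrite seq_right_iter E'.
Qed.

End Seq.

(** * Running a machine on some of the tapes of a larger one *)

Section Embed.
Variables (k K : nat) (s : 'I_k.+2 -> 'I_K.+2) (M : machine k).
Hypothesis s_inj : injective s.

Definition embedM : machine K :=
  @Machine K (state M) (start M) (@final k M)
    (fun q r => let: (q', a) := delta q [ffun j => r (s j)] in
      (q', [ffun i => if [pick j | s j == i] is Some j then a j else (r i, Stay)])).

Lemma embedM_iter n q (t : {ffun 'I_K.+2 -> tape}) :
  let c := iter n (@step K embedM) (q, t) in
  iter n (@step k M) (q, [ffun j => t (s j)]) = (c.1, [ffun j => c.2 (s j)]) /\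
  forall i, (forall j, s j != i) -> teq (c.2 i) (t i).
Proof.
elim: n => [|n [IH1 IH2]] //=; rewrite IH1.
case: (iter n _ _) IH2 => [p u] /= IH2; rewrite /step /=; case: ifP => // _.
rewrite (_ : [ffun i => tape_read ([ffun j => u (s j)] i)] =
  [ffun j => [ffun i => tape_read (u i)] (s j)]); last first.
  by apply/ffunP => j; rewrite !ffunE.
case: (delta _ _) => q' a /=; split.
  congr pair; apply/ffunP => j; rewrite !ffunE.
  case: pickP => [j' /eqP/s_inj -> //|/(_ j)]; by rewrite eqxx.
move=> i hi; rewrite !ffunE; case: pickP => [j /eqP E|_].
  by have := hi j; rewrite E eqxx.
by apply: teq_trans (IH2 i hi); apply: teq_idle.
Qed.

Lemma embedM_runs t n t' u :
  runs M (t \o s) n t' -> (forall j, teq (t' j) (u (s j))) ->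
  (forall i, (forall j, s j != i) -> teq (t i) (u i)) -> runs embedM t n u.
Proof.
move=> [q fq [m [v [mn E hv]]]] h1 h2; exists q => //.
have [] := embedM_iter m (start M) [ffun i => t i].
rewrite (_ : [ffun j => _] = [ffun j => (t \o s) j]); last first.
  by apply/ffunP => j; rewrite !ffunE.
rewrite E; case E2 : (iter m _ _) => [p w] /= [? ?] h3; subst p v.
exists m, w; split=> // i.
case: (pickP (fun j => s j == i)) => [j /eqP <-|hi].
  by apply: teq_trans (h1 j); have := hv j; rewrite ffunE.
apply: teq_trans (h2 i _); last by move=> j; rewrite hi.
by have := h3 i; rewrite ffunE; apply=> j; rewrite hi.
Qed.

End Embed.

Definition upd k (t : 'I_k -> tape) (a : 'I_k) (x : tape) : 'I_k -> tape :=
  fun i => if i == a then x else t i.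

(** * Rewinding a head *)

Section Rewind.
Variables (k : nat) (a : 'I_k.+2).

Definition act_on (s : {ffun 'I_k.+2 -> symbol}) (x : symbol) (m : move) :
    {ffun 'I_k.+2 -> symbol * move} :=
  [ffun i => if i == a then (x, m) else (s i, Stay)].

Lemma act_onP (t : 'I_k.+2 -> tape) x m u :
  teq (tape_act (x, m) (t a)) u ->
  forall i, teq (tape_act (act_on [ffun i => tape_read (t i)] x m i) (t i))
    (upd t a u i).
Proof.
move=> h i; rewrite /upd !ffunE; case: eqP => [->|_] //; exact: teq_idle.
Qed.

(** State [None] makes one unconditional step left, because the head starts just after the string
    and may scan a blank there. [Some false] walks left over the bits until the blank before
    them. *)
Definition rewindM : machine k :=
  @Machine k (option bool) None (fun q => q == Some true)
    (fun q s => if q is Some _ then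
        if s a is Some x then (Some false, act_on s (Some x) MoveL)
        else (Some true, act_on s None MoveR)
      else (Some false, act_on s (s a) MoveL)).

(** [v] is the part still to be crossed, nearest symbol first. The tape has the form that [MoveL]
    produces from [(map Some v, r)], which makes the induction on [v] match one step. *)
Lemma rewind_loop (t : 'I_k.+2 -> tape) (v : bitseq) r :
  reach (M := rewindM)
    (Some false) (upd t a (behead (map Some v), head None (map Some v) :: r)) (size v).+1
    (Some true) (upd t a ([::], map Some (rev v) ++ r)).
Proof.
elim: v r => [|y v IH] r /=.
  apply: reach_step => //=; first by rewrite ffunE /upd eqxx.
  move=> i; apply: teq_trans (act_onP (u := ([::], r)) _ i) _.
    by rewrite /upd eqxx; split=> // -[|[|j]].
  by rewrite /upd; case: eqP.
rewrite rev_cons map_rcons cat_rcons.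
apply: reach_next (IH (Some y :: r)) => //=; first by rewrite ffunE /upd eqxx.
move=> i; apply: teq_trans (act_onP _ i) _.
  by rewrite /upd eqxx; apply: teq_refl.
by rewrite /upd; case: eqP.
Qed.

Lemma rewindM_runs (t : 'I_k.+2 -> tape) (v : bitseq) r :
  teq (t a) (map Some (rev v), r) ->
  runs rewindM t (size v).+2 (upd t a ([::], map Some v ++ r)).
Proof.
move=> ht; exists (Some true) => //.
have := rewind_loop t (rev v) r; rewrite size_rev revK; apply: reach_next => //=.
move=> i; apply: teq_trans (act_onP (teq_act _ ht) i) _.
rewrite /upd; case: eqP => // _; split=> // -[|j] //=.
rewrite ffunE (teq_read ht) /tape_read /= -nth0.
by case: j => [|j] /=; rewrite ?nth0 ?nth_behead.
Qed.

End Rewind.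

(** * Moving a string to another tape *)

Section Move.
Variables (k : nat) (a b : 'I_k.+2).
Hypothesis ab : a != b.

(** The source is erased during the copy, so that it can later receive an output or another string
    as a blank tape. *)
Definition copyM : machine k :=
  @Machine k bool false id
    (fun _ s => if s a is Some x then
        (false, [ffun i => if i == a then (None, MoveR)
          else if i == b then (Some x, MoveR) else (s i, Stay)])
      else (true, [ffun i => (s i, Stay)])).

Lemma copyM_runs (t : 'I_k.+2 -> tape) l (u : bitseq) r lb :
  teq (t a) (l, map Some u ++ None :: r) -> teq (t b) (lb, [::]) ->
  runs copyM t (size u).+1
    (upd (upd t a (nseq (size u) None ++ l, None :: r)) b
       (rev (map Some u) ++ lb, [::])).
Proof.
move=> ha hb; exists true => //=.
elim: u t l lb ha hb => [|x u IH] t l lb ha hb /=.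
  apply: reach_step => //=.
    by rewrite ffunE (teq_read ha) /=; reflexivity.
  move=> i; rewrite !ffunE; apply: teq_trans (teq_idle _) _.
  by rewrite /upd; case: eqP => [->|_] //; case: eqP => [->|_].
set t1 := upd (upd t a (None :: l, map Some u ++ None :: r)) b (Some x :: lb, [::]).
have h1 : teq (t1 a) (None :: l, map Some u ++ None :: r).
  by rewrite /t1 /upd (negbTE ab) eqxx.
have h2 : teq (t1 b) (Some x :: lb, [::]) by rewrite /t1 /upd eqxx.
have {IH h1 h2} := IH t1 _ _ h1 h2.
move=> /(reach_teqs (fun i => teq_refl _)) IH.
apply: reach_next (IH _ _) => //=.
- by rewrite ffunE (teq_read ha) /=; reflexivity.
- move=> i; rewrite !ffunE /t1 /upd.
  case: eqP => [->|_]; first by rewrite (negbTE ab); apply: (@teq_act (None, MoveR) _ _ ha).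
  case: eqP => [->|_]; first exact: (@teq_act (Some x, MoveR) _ _ hb).
  exact: teq_idle.
move=> i; rewrite /t1 /upd; case: eqP => _.
  by rewrite rev_cons cat_rcons.
case: eqP => // _; rewrite -[None :: l]/(nseq 1 None ++ l) catA -nseqD addn1.
exact: teq_refl.
Qed.

Definition moveM : machine k := seqM copyM (rewindM b).

Lemma moveM_runs (t : 'I_k.+2 -> tape) l (u : bitseq) r :
  teq (t a) (l, map Some u ++ None :: r) -> teq (t b) blank ->
  runs moveM t ((size u).*2 + 3)
    (upd (upd t a (nseq (size u) None ++ l, None :: r)) b ([::], map Some u)).
Proof.
move=> ha hb; have h := copyM_runs ha hb.
set t1 := upd _ _ _ in h.
have h1 : teq (t1 b) (map Some (rev u), [::]) by rewrite /t1 /upd eqxx cats0 map_rev.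
have {h} := seqM_runs h (rewindM_runs h1).
move=> /(runs_leq (n := (size u).*2 + 3)) h.
apply: runs_teqs (h _); [by [] | | by lia].
by move=> i; rewrite cats0 /t1 /upd; case: eqP.
Qed.

End Move.

(** * Replacing an argument by the output of another machine *)

Section Compose.
Variables (k K : nat) (M : machine k) (N : machine K) (a : 'I_k.+2).

Definition left_tape (i : 'I_k.+2) : 'I_(k + K.+2).+2 := lshift K.+2 i.
Definition right_tape (i : 'I_K.+2) : 'I_(k + K.+2).+2 := rshift k.+2 i.

Lemma left_right_neq i j : left_tape i != right_tape j.
Proof. by apply/eqP => /(congr1 val) /=; have := ltn_ord i; lia. Qed.

Lemma left_tape_inj : injective left_tape. Proof. exact: (@lshift_inj k.+2 K.+2). Qed.
Lemma right_tape_inj : injective right_tape. Proof. exact: (@rshift_inj k.+2 K.+2). Qed.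

Lemma tape_cases i : (exists j, i = left_tape j) \/ (exists j, i = right_tape j).
Proof.
rewrite -(@splitK k.+2 K.+2 i); case: split => j /=; [left|right]; by exists j.
Qed.

(** [N] gets tapes of its own, since it may leave garbage on all of them while
    [M] expects blank ones. *)
Definition composeM : machine (k + K.+2) :=
  seqM (moveM (left_tape a) (right_tape ord0))
    (seqM (embedM right_tape N)
      (seqM (moveM (right_tape ord0) (left_tape a)) (embedM left_tape M))).

Lemma composeM_outputs (args : seq bitseq) (x y : bitseq) n m out :
  nth [::] args a = x -> size args <= k.+2 ->
  outputs_within N [:: x] n y ->
  outputs_within M (set_nth [::] args a y) m out ->
  outputs_within composeM args
    ((size x).*2 + 3 + (n + ((size y).*2 + 3 + m))) out.
Proof.
move=> ax args_k /outputs_runs [u [hN uy _]] /outputs_runs [v [hM vo _]].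
set t0 := (init composeM args).2 : 'I_(k + K.+2).+2 -> tape.
have t0l i : t0 (left_tape i) = ([::], map Some (nth [::] args i)) by rewrite /t0 ffunE.
have t0r i : t0 (right_tape i) = blank.
  rewrite /t0 ffunE nth_default //=; exact: leq_trans args_k (leq_addr _ _).
(* [t1] to [t4] are the tapes after the four stages of [composeM]. *)
pose t1 := upd (upd t0 (left_tape a) blank) (right_tape ord0) ([::], map Some x).
have r1 : runs (moveM (left_tape a) (right_tape ord0)) t0 ((size x).*2 + 3) t1.
  have ha : teq (t0 (left_tape a)) ([::], map Some x ++ None :: [::]).
    rewrite t0l ax; split=> // i /=; rewrite nth_cat.
    by case: ltnP => // h; rewrite nth_default //; case: (i - _) => [|[|]].
  have hb : teq (t0 (right_tape ord0)) blank by rewrite t0r.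
  apply: runs_teqs (moveM_runs (left_right_neq _ _) ha hb); first by [].
  move=> i; rewrite /t1 /upd; case: eqP => // _; case: eqP => // _.
  by rewrite cats0; apply: (teq_blanks _ 1).
pose t2 i := if [pick j | right_tape j == i] is Some j then u j else t1 i.
have t2r j : t2 (right_tape j) = u j.
  by rewrite /t2; case: pickP => [j' /eqP/right_tape_inj -> //|/(_ j)]; rewrite eqxx.
have t2l j : t2 (left_tape j) = t1 (left_tape j).
  rewrite /t2; case: pickP => [j' /eqP E|//].
  by have := left_right_neq j j'; rewrite E eqxx.
have r2 : runs (embedM right_tape N) t1 n t2.
  apply: (embedM_runs right_tape_inj (t' := u)).
  - apply: runs_teqs hN => // i; rewrite ffunE /= /t1 /upd (inj_eq right_tape_inj).
    case: (eqVneq i ord0) => [->|i0] //=.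
    rewrite eq_sym (negbTE (left_right_neq _ _)) t0r.
    by case: i i0 => [[|[|i]] hi].
  - by move=> j; rewrite t2r.
  - move=> i hi; have [[j ->]|[j ij]] := tape_cases i; first by rewrite t2l.
    by have := hi j; rewrite ij eqxx.
(* [N] may leave garbage [r] behind the blank that ends [y]; the second move stops at this blank. *)
have [r hr] := bits_upto_blank_split (t2 (right_tape ord0)).2.
have ha : teq (t2 (right_tape ord0)) ((t2 (right_tape ord0)).1, map Some y ++ None :: r).
  by split=> // i; rewrite -uy -(t2r ord0) hr.
have hb : teq (t2 (left_tape a)) blank.
  by rewrite t2l /t1 /upd (negbTE (left_right_neq _ _)) eqxx.
have nrl : right_tape ord0 != left_tape a by rewrite eq_sym left_right_neq.
have r3 := moveM_runs nrl ha hb.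
set t3 := upd _ _ _ in r3.
pose t4 i := if [pick j | left_tape j == i] is Some j then v j else t3 i.
have r4 : runs (embedM left_tape M) t3 m t4.
  apply: (embedM_runs left_tape_inj (t' := v)).
  - apply: runs_teqs hM => // i; rewrite ffunE /= /t3 /upd (inj_eq left_tape_inj).
    rewrite nth_set_nth /=; rewrite -(inj_eq val_inj); case: eqP => // ia.
    rewrite (negbTE (left_right_neq _ _)) t2l /t1 /upd (negbTE (left_right_neq _ _)).
    rewrite (inj_eq left_tape_inj); case: eqP => [ii|_]; first by case: ia; rewrite ii.
    by rewrite t0l.
  - move=> j; rewrite /t4; case: pickP => [j' /eqP/left_tape_inj -> //|/(_ j)].
    by rewrite eqxx.
  - move=> i hi; rewrite /t4; case: pickP => [j' E|//]; by have := hi j'; rewrite E.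
have := runs_outputs (seqM_runs r1 (seqM_runs r2 (seqM_runs r3 r4))) (fun i => teq_refl _).
rewrite (_ : t4 ord0 = v ord0) ?vo //.
have e0 : ord0 = left_tape ord0 :> 'I_(k + K.+2).+2 by apply: val_inj.
by rewrite /t4 e0; case: pickP => [j' /eqP/left_tape_inj -> //|/(_ ord0)]; rewrite eqxx.
Qed.

End Compose.

(** * Closure of polynomial time under composition *)

Lemma outputs_within_leq k (M : machine k) args m n out :
  m <= n -> outputs_within M args m out -> outputs_within M args n out.
Proof.
move=> mn [f o]; rewrite /outputs_within -(subnK mn) iterD iter_step_final //.
Qed.

(** The size of an intermediate result is known only up to an upper bound, so time bounds must be
    monotone before they are evaluated there. *)
Lemma poly_bounded_mono (T : nat -> nat) : poly_bounded T ->
  exists U, [/\ poly_bounded U, forall n, T n <= U n & {homo U : m n / m <= n}].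
Proof.
move=> /poly_boundedP [e he]; exists (fun n => n.+2 ^ e); split=> //.
  by apply/poly_boundedP; exists e.
by move=> m n mn; case: e {he} => // e; rewrite leq_exp2r.
Qed.

Lemma poly_bounded_double T : poly_bounded T -> poly_bounded (fun n => (T n).*2).
Proof.
by move=> pT; apply: poly_bounded_le (poly_boundedD pT pT) => n; rewrite addnn.
Qed.

Section PolytimeComp.
Variables (h : bitseq -> bitseq) (K : nat) (N : machine K) (U : nat -> nat).
Hypotheses (pU : poly_bounded U) (mU : {homo U : m n / m <= n}).
Hypothesis hN : forall x, outputs_within N [:: x] (U (size x)) (h x).

(** Here [n + (U n).*2] bounds the intermediate string. The extra [n] in the argument of [T]
    accounts for the other argument of a binary function, so one formula serves both composition
    lemmas. *)
Definition compose_time (T : nat -> nat) (n : nat) : nat :=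
  n.*2 + 3 + (U n + ((n + (U n).*2).*2 + 3 + T (n + (n + (U n).*2)))).

Lemma poly_bounded_compose_time T : poly_bounded T -> poly_bounded (compose_time T).
Proof.
move=> pT; have p1 := poly_boundedD poly_bounded_id (poly_bounded_double pU).
have p3 := poly_bounded_const 3.
apply: poly_boundedD.
  exact: poly_boundedD (poly_bounded_double poly_bounded_id) p3.
apply: poly_boundedD pU _; apply: poly_boundedD.
  exact: poly_boundedD (poly_bounded_double p1) p3.
exact: poly_bounded_comp pT (poly_boundedD poly_bounded_id p1).
Qed.

Lemma size_polytime x : size (h x) <= size x + (U (size x)).*2.
Proof. by have [t []] := outputs_runs (hN x). Qed.

End PolytimeComp.

Lemma polytime1_comp g h : polytime1 g -> polytime1 h -> polytime1 (g \o h).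
Proof.
move=> [k [M [T [/poly_bounded_mono [T' [pT TT' mT]] hM]]]].
move=> [K [N [U [/poly_bounded_mono [U' [pU UU' mU]] hN]]]].
have {}hN x := outputs_within_leq (UU' _) (hN x).
have {}hM x := outputs_within_leq (TT' _) (hM x).
exists (k + K.+2), (composeM M N ord0), (compose_time U' T').
split=> [|x]; first exact: poly_bounded_compose_time.
have := @composeM_outputs _ _ M N ord0 [:: x] x (h x) _ _ _ erefl isT (hN x) (hM (h x)).
apply: outputs_within_leq; rewrite /compose_time; have := size_polytime hN x => sy.
by do !apply: leq_add => //; rewrite ?leq_double //; apply: mT; lia.
Qed.

Lemma polytime2_comp g h :
  polytime2 g -> polytime1 h -> polytime2 (fun x s => g x (h s)).
Proof.
move=> [k [M [T [/poly_bounded_mono [T' [pT TT' mT]] hM]]]].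
move=> [K [N [U [/poly_bounded_mono [U' [pU UU' mU]] hN]]]].
have {}hN x := outputs_within_leq (UU' _) (hN x).
have {}hM x y := outputs_within_leq (TT' _) (hM x y).
exists (k + K.+2), (composeM M N (Ordinal (isT : 1 < k.+2))), (compose_time U' T').
split=> [|x s]; first exact: poly_bounded_compose_time.
have := @composeM_outputs _ _ M N (Ordinal (isT : 1 < k.+2)) [:: x; s] s (h s)
  _ _ _ erefl isT (hN s) (hM x (h s)).
apply: outputs_within_leq; rewrite /compose_time; have := size_polytime hN s => sy.
have Us : U' (size s) <= U' (size x + size s) by apply: mU; rewrite leq_addl.
by do !apply: leq_add => //; rewrite ?leq_double //; try apply: mT; lia.
Qed.

(** * Counter transducers *)

Inductive instr := Emit of bool | Push of bool | EmitCount of bool.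

Definition count_of (b : bool) (v : nat * nat) : nat := if b then v.2 else v.1.

Definition instr_out (i : instr) (v : nat * nat) : bitseq :=
  match i with
  | Emit x => [:: x]
  | Push _ => [::]
  | EmitCount b => nseq (count_of b v) true
  end.

Definition instr_count (i : instr) (v : nat * nat) : nat * nat :=
  match i with
  | Push true => (v.1, v.2.+1)
  | Push false => (v.1.+1, v.2)
  | _ => v
  end.

Fixpoint exec (l : seq instr) (v : nat * nat) : bitseq * (nat * nat) :=
  if l is i :: l' then
    let r := exec l' (instr_count i v) in (instr_out i v ++ r.1, r.2)
  else ([::], v).

Section Transducer.
Variables (Q : finType) (tr : Q -> bool -> Q * seq instr).

(** The output, the last state and the final counters. *)
Fixpoint scan (q : Q) (v : nat * nat) (w : bitseq) : bitseq * Q * (nat * nat) :=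
  if w is b :: w' then
    let e := exec (tr q b).2 v in
    let r := scan (tr q b).1 e.2 w' in
    (e.1 ++ r.1.1, r.1.2, r.2)
  else ([::], q, v).

Fixpoint passes (qs : seq Q) (v : nat * nat) (w : bitseq) : bitseq :=
  if qs is q :: qs' then
    let r := scan q v w in r.1.1 ++ passes qs' r.2 w
  else [::].

(** This bound makes the program position range over the finite type ['I_max_instrs.+1], whose extra
    value allows for the position after the last instruction. *)
Definition max_instrs : nat := \max_(x : Q * bool) size (tr x.1 x.2).2.

Lemma size_instrs q b : size (tr q b).2 <= max_instrs.
Proof. exact: (@leq_bigmax _ (fun x : Q * bool => size (tr x.1 x.2).2) (q, b)). Qed.

(** The output is written on tape 0, the input is read on tape 1, and the
    counters are kept in unary on tapes 2 and 3. *)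
Definition in_tape : 'I_4 := @Ordinal 4 1 isT.
Definition count_tape (c : bool) : 'I_4 :=
  if c then @Ordinal 4 3 isT else @Ordinal 4 2 isT.

Definition conf (o : bitseq) (inp : tape) (f : bool -> tape) (i : 'I_4) : tape :=
  match val i with
  | 0 => (rev (map Some o), [::])
  | 1 => inp
  | 2 => f false
  | _ => f true
  end.

Definition set_count (f : bool -> tape) (c : bool) (x : tape) (c' : bool) :=
  if c' == c then x else f c'.

Lemma upd_out o inp f x i :
  upd (conf o inp f) ord0 (Some x :: rev (map Some o), [::]) i =
  conf (rcons o x) inp f i.
Proof.
by rewrite /upd; case: i => [[|[|[|[|i]]]] hi] //=;
  rewrite /conf /= map_rcons rev_rcons.
Qed.

Lemma upd_in o inp f x i : upd (conf o inp f) in_tape x i = conf o x f i.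
Proof. by rewrite /upd; case: i => [[|[|[|[|i]]]] hi]. Qed.

Lemma upd_count o inp f c x i :
  upd (conf o inp f) (count_tape c) x i = conf o inp (set_count f c x) i.
Proof. by rewrite /upd; case: i c => [[|[|[|[|i]]]] hi] []. Qed.

Lemma conf_count o inp f c : conf o inp f (count_tape c) = f c.
Proof. by case: c. Qed.

Lemma conf_teqs o inp inp' f f' : teq inp inp' -> (forall c, teq (f c) (f' c)) ->
  teqs (k := 2) (conf o inp f) (conf o inp' f').
Proof. by move=> h1 h2 [[|[|[|[|i]]]] hi] //; apply: h2. Qed.

Lemma set_count_id f c x c' : teq x (f c) -> teq (set_count f c x c') (f c').
Proof. by rewrite /set_count; case: eqP => [->|]. Qed.

(** [None] is the final state; [Some (q, None)] reads the next input symbol;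
    [Some (q, Some (b, p, mode))] has read [b] and executes the [p]-th
    instruction, where an [EmitCount] first walks left along its counter while
    emitting (mode [Some false]) and then back (mode [Some true]). *)
Definition scan_delta (st : option (Q * option (bool * 'I_max_instrs.+1 * option bool)))
    (s : {ffun 'I_4 -> symbol}) :
    option (Q * option (bool * 'I_max_instrs.+1 * option bool)) *
    {ffun 'I_4 -> symbol * move} :=
  let stay := @act_on 2 in_tape s (s in_tape) Stay in
  match st with
  | None => (None, stay)
  | Some (q, None) =>
      if s in_tape is Some b then (Some (q, Some (b, ord0, None)), stay)
      else (None, stay)
  | Some (q, Some (b, p, mode)) =>
      let l := (tr q b).2 in
      let next := Some (q, Some (b, inord p.+1, None)) in
      if p < size l then
        match nth (Emit false) l p, mode with
        | Emit x, _ => (next, @act_on 2 ord0 s (Some x) MoveR)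
        | Push c, _ => (next, @act_on 2 (count_tape c) s (Some true) MoveR)
        | EmitCount c, None =>
            (Some (q, Some (b, p, Some false)),
             @act_on 2 (count_tape c) s (s (count_tape c)) MoveL)
        | EmitCount c, Some false =>
            if s (count_tape c) is Some x then
              (st, [ffun i => if i == ord0 then (Some true, MoveR)
                              else @act_on 2 (count_tape c) s (Some x) MoveL i])
            else (Some (q, Some (b, p, Some true)),
                  @act_on 2 (count_tape c) s None MoveR)
        | EmitCount c, Some true =>
            if s (count_tape c) is Some x then
              (st, @act_on 2 (count_tape c) s (Some x) MoveR)
            else (next, @act_on 2 (count_tape c) s None Stay)
        end
      else (Some ((tr q b).1, None), @act_on 2 in_tape s (s in_tape) MoveR)
  end.

(** * Correctness and running time of one reading *)

Definition scanM (q : Q) : machine 2 :=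
  @Machine 2 _ (Some (q, None)) (fun st => st == None) scan_delta.

(** All strokes lie to the left of the head, so incrementing is a single write. *)
Definition unary (v : nat * nat) (c : bool) : tape :=
  (nseq (count_of c v) (Some true), [::]).

(** The way back emits nothing; [a] strokes are already crossed and [n] remain. *)
Lemma forth_reach q0 q b (p : 'I_max_instrs.+1) c a n o inp f : p < size (tr q b).2 ->
  nth (Emit false) (tr q b).2 p = EmitCount c ->
  reach (M := scanM q0) (Some (q, Some (b, p, Some true)))
    (conf o inp (set_count f c (nseq a (Some true), nseq n (Some true)))) n.+1
    (Some (q, Some (b, inord p.+1, None)))
    (conf o inp (set_count f c (nseq (n + a) (Some true), [::]))).
Proof.
move=> lp np; elim: n a => [|n IH] a.
  apply: reach_step => //.
    rewrite /= lp np ffunE conf_count /set_count eqxx /=; reflexivity.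
  move=> i; apply: teq_trans (act_onP (teq_refl _) i) _; rewrite upd_count.
  apply: conf_teqs => // c'; rewrite conf_count /set_count eqxx.
  by case: eqP => // _; apply: (teq_idle (_, [::])).
rewrite addSnnS; apply: reach_next (IH a.+1) => //.
  by rewrite /= lp np ffunE conf_count /set_count eqxx /=; reflexivity.
move=> i; apply: teq_trans (act_onP (teq_refl _) i) _; rewrite upd_count.
by apply: conf_teqs => // c'; rewrite conf_count /set_count eqxx; case: eqP.
Qed.

(** Each of the [a] strokes still to be crossed leftwards emits one [true]. As in [rewind_loop], the
    counter tape is in the form left by [MoveL]. *)
Lemma back_reach q0 q b (p : 'I_max_instrs.+1) c a n o inp f : p < size (tr q b).2 ->
  nth (Emit false) (tr q b).2 p = EmitCount c ->
  reach (M := scanM q0) (Some (q, Some (b, p, Some false)))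
    (conf o inp (set_count f c (behead (nseq a (Some true)),
       head None (nseq a (Some true)) :: nseq n (Some true)))) a.+1
    (Some (q, Some (b, p, Some true)))
    (conf (o ++ nseq a true) inp (set_count f c ([::], nseq (a + n) (Some true)))).
Proof.
move=> lp np; elim: a n o => [|a IH] n o.
  rewrite cats0; apply: reach_step => //.
    by rewrite /= lp np ffunE conf_count /set_count eqxx /=; reflexivity.
  move=> i; apply: teq_trans (act_onP (teq_refl _) i) _; rewrite upd_count.
  apply: conf_teqs => // c'; rewrite conf_count /set_count eqxx.
  by case: eqP => // _; split=> // -[|[|j]].
rewrite addSnnS (_ : o ++ nseq a.+1 true = rcons o true ++ nseq a true); last first.
  by rewrite cat_rcons.
apply: reach_next (IH n.+1 (rcons o true)) => //.
  by rewrite /= lp np ffunE conf_count /set_count eqxx /=; reflexivity.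
move=> i; rewrite ffunE; case: eqP => [->|i0].
  by rewrite /conf /= map_rcons rev_rcons.
apply: teq_trans (act_onP (teq_refl _) i) _; rewrite upd_count conf_count /set_count eqxx.
move: i i0 => [[|[|[|[|i]]]] hi] //= i0; first by case: i0; apply: val_inj.
all: by rewrite /conf /=; case: (_ == c); split.
Qed.

Lemma instr_reach q0 q b (p : 'I_max_instrs.+1) i o inp v V : p < size (tr q b).2 ->
  nth (Emit false) (tr q b).2 p = i -> count_of false v <= V -> count_of true v <= V ->
  reach (M := scanM q0) (Some (q, Some (b, p, None))) (conf o inp (unary v)) (V.*2 + 3)
    (Some (q, Some (b, inord p.+1, None)))
    (conf (o ++ instr_out i v) inp (unary (instr_count i v))).
Proof.
move=> lp np v0 v1; case: i np => [x|c|c] np.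
- apply: (@reach_leq _ _ _ _ 1); first by lia.
  apply: reach_step => //; first by rewrite /= lp np; reflexivity.
  move=> i; apply: teq_trans (act_onP (teq_refl _) i) _.
  rewrite /= cats1 -upd_out; exact: teq_refl.
- apply: (@reach_leq _ _ _ _ 1); first by lia.
  rewrite cats0; apply: reach_step => //; first by rewrite /= lp np; reflexivity.
  move=> i; apply: teq_trans (act_onP (teq_refl _) i) _.
  rewrite /= upd_count; apply: conf_teqs => // c'.
  by rewrite conf_count /set_count; case: c c' {np} => [] [].
set m := count_of c v.
have mV : m <= V by rewrite /m; clear m np; case: c.
(* One step enters the counter, and each direction takes [m] strokes and one blank. *)
rewrite /=; apply: (@reach_leq _ _ _ _ (m.+1 + m.+1).+1); first by lia.
have back := @back_reach q0 q b p c m 0 o inp (unary v) lp np.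
have forth := @forth_reach q0 q b p c 0 m (o ++ nseq m true) inp (unary v) lp np.
rewrite !addn0 in back forth; have := reach_trans back forth.
move=> /(reach_teqs (fun i => teq_refl _)) R.
apply: reach_next (R _ _) => //.
- by rewrite /= lp np; reflexivity.
- move=> i; apply: teq_trans (act_onP (teq_refl _) i) _; rewrite upd_count.
  apply: conf_teqs => // c'; rewrite ffunE conf_count /set_count.
  case: eqP => // _; rewrite /unary -/m; split=> //= -[|[|j]] //=; by rewrite nth_nil.
- by apply: conf_teqs => // c1; apply: set_count_id.
Qed.

(** The induction is on the remaining instructions [l]. An instruction adds at most one stroke while
    [l] gets shorter by one, so the bound by [V] is preserved. *)
Lemma exec_reach q0 q b l (p : 'I_max_instrs.+1) o inp v V :
  p <= size (tr q b).2 -> drop p (tr q b).2 = l -> v.1 + v.2 + size l <= V ->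
  reach (M := scanM q0) (Some (q, Some (b, p, None))) (conf o inp (unary v))
    (size l * (V.*2 + 3))
    (Some (q, Some (b, inord (size (tr q b).2), None)))
    (conf (o ++ (exec l v).1) inp (unary (exec l v).2)).
Proof.
elim: l p o v => [|i l IH] p o v lep dp hV.
  have ep : p = size (tr q b).2 :> nat.
    by apply/eqP; rewrite eqn_leq lep -subn_eq0 -size_drop dp.
  rewrite (_ : inord _ = p); last by apply: val_inj; rewrite /= -ep inordK.
  rewrite cats0; exact: reach_refl.
have lp : p < size (tr q b).2 by rewrite -subn_gt0 -size_drop dp.
have np : nth (Emit false) (tr q b).2 p = i.
  by rewrite -(addn0 p) -nth_drop dp.
have ep : @inord max_instrs p.+1 = p.+1 :> nat.
  by rewrite inordK // ltnS; apply: leq_trans lp (size_instrs q b).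
rewrite /= mulSn catA; apply: reach_trans (IH (inord p.+1) _ _ _ _ _).
- by apply: instr_reach => //; move: hV => /=; lia.
- by rewrite ep.
- by rewrite ep -add1n -drop_drop dp /= drop0.
- by move: hV; case: (i) => // -[] /=; lia.
Qed.

Lemma exec_count l v : (exec l v).2.1 + (exec l v).2.2 <= v.1 + v.2 + size l.
Proof.
elim: l v => [|i l IH] v /=; first by lia.
by apply: leq_trans (IH _) _; case: i => // [x|[]|x] /=; lia.
Qed.

Lemma size_exec l v V : v.1 + v.2 + size l <= V ->
  size (exec l v).1 <= size l * V.
Proof.
elim: l v => [|i l IH] v //= hV; rewrite size_cat mulSn leq_add //.
  by case: i => //= [_|c]; rewrite ?size_nseq /count_of; [|case: c]; lia.
by apply: IH; case: i => // [x|[]|x] /=; lia.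
Qed.

Lemma scan_count q v w :
  (scan q v w).2.1 + (scan q v w).2.2 <= v.1 + v.2 + max_instrs * size w.
Proof.
elim: w q v => [|b w IH] q v /=; first by lia.
apply: leq_trans (IH _ _) _; have := exec_count (tr q b).2 v.
by have := size_instrs q b; nia.
Qed.

Lemma size_scan q v w V : v.1 + v.2 + max_instrs * size w <= V ->
  size (scan q v w).1.1 <= size w * (max_instrs * V).
Proof.
elim: w q v => [|b w IH] q v //= hV; rewrite size_cat mulSn.
have h1 := size_instrs q b; have h2 := exec_count (tr q b).2 v.
apply: leq_add; last by apply: IH; nia.
apply: (@leq_trans (size (tr q b).2 * V)); last by rewrite leq_mul2r h1 orbT.
by apply: size_exec; nia.
Qed.

(** Each input symbol costs its instructions plus two steps, to read it and to move past it; the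
    last step detects the final blank. *)
Definition scan_time (n V : nat) : nat := n * (max_instrs * (V.*2 + 3) + 2) + 1.

Lemma scan_reach q0 q w o l v V : v.1 + v.2 + max_instrs * size w <= V ->
  reach (M := scanM q0) (Some (q, None)) (conf o (l, map Some w) (unary v))
    (scan_time (size w) V)
    None (conf (o ++ (scan q v w).1.1) (rev (map Some w) ++ l, [::])
      (unary (scan q v w).2)).
Proof.
rewrite /scan_time; elim: w q o l v => [|b w IH] q o l v hV.
  apply: (@reach_leq _ _ _ _ 1); first by lia.
  rewrite /= cats0; apply: reach_step => //.
    by rewrite /= ffunE; reflexivity.
  move=> i; apply: teq_trans (act_onP (teq_refl _) i) _.
  rewrite upd_in ?ffunE; apply: conf_teqs => //.
  exact: (teq_idle (l, [::])).
have h1 := size_instrs q b; have h2 := exec_count (tr q b).2 v.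
have hw : (exec (tr q b).2 v).2.1 + (exec (tr q b).2 v).2.2 + max_instrs * size w <= V.
  by move: hV => /=; nia.
have {IH} := IH (tr q b).1 (o ++ (exec (tr q b).2 v).1) (Some b :: l) _ hw.
rewrite -catA /= rev_cons cat_rcons => IH.
have he : v.1 + v.2 + size (tr q b).2 <= V by move: hV => /=; nia.
have E := @exec_reach q0 q b (tr q b).2 ord0 o (l, Some b :: map Some w) v V
  (leq0n _) (drop0 _) he.
apply: (@reach_leq _ _ _ _ (1 + (size (tr q b).2 * (V.*2 + 3) +
  (1 + (size w * (max_instrs * (V.*2 + 3) + 2) + 1))))).
  by rewrite mulSn; nia.
apply: reach_trans (reach_trans E (reach_trans _ IH)).
  apply: reach_step => //; first by rewrite /= ffunE; reflexivity.
  move=> i; apply: teq_trans (act_onP (teq_refl _) i) _.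
  rewrite upd_in ?ffunE; apply: conf_teqs => //.
apply: reach_step => //.
  by rewrite /= inordK ?ltnS // ltnn; reflexivity.
move=> i; apply: teq_trans (act_onP (teq_refl _) i) _.
by rewrite upd_in ?ffunE; apply: conf_teqs.
Qed.

(** * Several readings of the input *)

Definition idleM k : machine k :=
  @Machine k unit tt predT (fun _ s => (tt, [ffun i => (s i, Stay)])).

Fixpoint passesM (qs : seq Q) : machine 2 :=
  if qs is q :: qs' then seqM (scanM q) (seqM (@rewindM 2 in_tape) (passesM qs'))
  else idleM 2.

Definition pass_time (n V : nat) : nat := scan_time n V + (n + 2).

(** Counters survive from one reading to the next, so a single [V] has to bound them over all the
    readings. *)
Lemma passesM_runs qs o w v V : v.1 + v.2 + size qs * (max_instrs * size w) <= V ->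
  exists2 v', runs (passesM qs) (conf o ([::], map Some w) (unary v))
      (size qs * pass_time (size w) V)
      (conf (o ++ passes qs v w) ([::], map Some w) (unary v')) &
    size (passes qs v w) <= size qs * (size w * (max_instrs * V)).
Proof.
elim: qs o v => [|q qs IH] o v.
  by exists v => //; rewrite cats0; exists tt => //; apply: reach_refl.
rewrite /= mulSn => hV; have h := scan_count q v w.
have [|v' r3 h3] := IH (o ++ (scan q v w).1.1) (scan q v w).2; first by lia.
exists v'; last first.
  by rewrite size_cat [in X in _ <= X]mulSn leq_add //; apply: size_scan; lia.
rewrite catA mulSn -addnA; apply: seqM_runs.
  by exists None => //; apply: scan_reach; lia.
apply: seqM_runs r3; rewrite cats0.
have hin : teq (conf (o ++ (scan q v w).1.1) (rev (map Some w), [::])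
    (unary (scan q v w).2) in_tape) (map Some (rev w), [::]) by rewrite map_rev.
have := rewindM_runs (k := 2) hin; rewrite -(addn2 (size w)); apply: runs_teqs => // i.
by rewrite upd_in cats0; apply: teq_refl.
Qed.

Lemma polytime1_passes qs : polytime1 (passes qs (0, 0)).
Proof.
(* The argument arrives on tape 0, where the output belongs, and is first moved to tape 1; finally
   the output is rewound. *)
pose M := seqM (@moveM 2 ord0 in_tape) (seqM (passesM qs) (@rewindM 2 ord0)).
pose V n := size qs * (max_instrs * n).
exists 2, M, (fun n => n.*2 + 3 + (size qs * pass_time n (V n) +
  (size qs * (n * (max_instrs * V n)) + 2))).
have pc := poly_bounded_const; have pi := poly_bounded_id.
have pV : poly_bounded V by exact: poly_boundedM (pc _) (poly_boundedM (pc _) pi).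
split.
  rewrite /pass_time /scan_time.
  repeat first [exact: pi | exact: pc | exact: pV | apply: poly_bounded_double
    | apply: poly_boundedD | apply: poly_boundedM].
move=> w; set o := passes qs (0, 0) w.
have [v' r2 so] : exists2 v', runs (passesM qs) (conf [::] ([::], map Some w) (unary (0, 0)))
    (size qs * pass_time (size w) (V (size w)))
    (conf o ([::], map Some w) (unary v')) &
    size o <= size qs * (size w * (max_instrs * V (size w))).
  exact: passesM_runs.
have ho : teq (conf o ([::], map Some w) (unary v') ord0) (map Some (rev o), [::]).
  by rewrite map_rev.
have r3 := rewindM_runs (k := 2) ho.
pose t0 := (init M [:: w]).2 : 'I_4 -> tape.
have h0 : teq (t0 ord0) ([::], map Some w ++ None :: [::]).
  rewrite /t0 ffunE; split=> // i /=; rewrite nth_cat.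
  by case: ltnP => // h; rewrite nth_default //; case: (i - _) => [|[|]].
have h1 : teq (t0 in_tape) blank by rewrite /t0 ffunE.
have r1 := @moveM_runs 2 ord0 in_tape isT t0 _ _ _ h0 h1.
have {}r1 : runs (@moveM 2 ord0 in_tape) t0 ((size w).*2 + 3)
    (conf [::] ([::], map Some w) (unary (0, 0))).
  apply: runs_teqs r1 => //; rewrite cats0 => -[[|[|[|[|i]]]] hi] //=.
  - exact: (teq_blanks _ 1).
  - by rewrite /upd /= /t0 ffunE.
  - by rewrite /upd /= /t0 ffunE.
have := seqM_runs r1 (seqM_runs r2 r3); rewrite -/M => R.
have := runs_outputs R (args := [:: w]) (fun i => teq_refl _).
rewrite /upd /= cats0 bits_upto_blank_map; apply: outputs_within_leq.
by rewrite !leq_add2l addn2 !ltnS.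
Qed.

End Transducer.

(** * The reduction *)

(** The position within the code of a circuit. [YGate] and [YOut] read the unary header in the
    second and third readings; [Idx2] is a gate index followed by another one, [Idx1] the last index
    of a gate. *)
Inductive kind :=
  | Header | Skip | YGate | YOut | Out | OutNum | Gate
  | Tag0 | Tag1 | Tag2 | Tag3 | Tag4 | Input | Const | Idx1 | Idx2.

Definition kinds : seq kind :=
  [:: Header; Skip; YGate; YOut; Out; OutNum; Gate;
      Tag0; Tag1; Tag2; Tag3; Tag4; Input; Const; Idx1; Idx2].

Definition kind_code (q : kind) : 'I_16 :=
  inord match q with
  | Header => 0 | Skip => 1 | YGate => 2 | YOut => 3 | Out => 4 | OutNum => 5
  | Gate => 6 | Tag0 => 7 | Tag1 => 8 | Tag2 => 9 | Tag3 => 10 | Tag4 => 11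
  | Input => 12 | Const => 13 | Idx1 => 14 | Idx2 => 15
  end.

Lemma kind_codeK : cancel kind_code (fun i => nth Header kinds i).
Proof. by case; rewrite /= inordK. Qed.

HB.instance Definition _ := Finite.copy kind (can_type kind_codeK).

Definition emits (s : bitseq) : seq instr := map Emit s.

(** A gate or output index [a] becomes [a + n + 2]: the [n] is in counter
    [false] once the first [n] new gates have been written. *)
Definition shift_prefix : seq instr := emits [:: true; true] ++ [:: EmitCount false].

(** The boolean tells whether the gates are skipped rather than translated. *)
Definition mantel_step (q : bool * kind) (b : bool) : bool * kind * seq instr :=
  let (mute, s) := q in
  let go s' l : bool * kind * seq instr := (mute, s', if mute then [::] else l) in
  match s with
  | Header => if b then (q, emits [:: true; true])
      else (false, Skip, emits ([:: false] ++ (true :: enc_gate (GConst false)) ++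
                                (true :: enc_gate (GConst true))))
  | Skip => (q, [::])
  | YGate => if b then (q, emits [:: true; false] ++
        [:: EmitCount false; EmitCount false] ++ emits [:: true; false] ++ [:: Push false])
      else (false, Gate, [::])
  | YOut => if b then (q, emits [:: true; true; true] ++
        [:: EmitCount true] ++ emits [:: false] ++ [:: Push true])
      else (true, Gate, emits (true :: enc_nat 1))
  | Out => if b then (q.1, OutNum, emits [:: true] ++ shift_prefix)
      else (q.1, Skip, emits [:: false])
  | OutNum => (q.1, if b then OutNum else Out, emits [:: b])
  | Gate => if b then go Tag0 (emits [:: true])
      else if mute then (true, Out, [::])
      else (false, Skip, emits (false :: true :: enc_nat 0))
  | Tag0 => go (if b then Tag1 else Input) (emits [:: b])
  | Tag1 => go (if b then Tag2 else Const) (emits [:: b])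
  | Tag2 => if b then go Tag3 (emits [:: b]) else go Idx1 (emits [:: b] ++ shift_prefix)
  | Tag3 => if b then go Tag4 (emits [:: b]) else go Idx2 (emits [:: b] ++ shift_prefix)
  | Tag4 => if b then go Skip [::] else go Idx2 (emits [:: b] ++ shift_prefix)
  | Input => if b then go Input (emits [:: true; true]) else go Gate (emits [:: false])
  | Const => go Gate (emits [:: b])
  | Idx1 => go (if b then Idx1 else Gate) (emits [:: b])
  | Idx2 => if b then go Idx2 (emits [:: b]) else go Idx1 (emits [:: b] ++ shift_prefix)
  end.

(** The first reading writes the number of inputs and the constant gates, the
    second one the gates, and the third one the outputs. *)
Definition mantel_instance (w : bitseq) : bitseq :=
  passes mantel_step [:: (false, Header); (false, YGate); (false, YOut)] (0, 0) w.

Definition shift_gate (n : nat) (g : gate) : gate :=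
  match g with
  | GInput i => GInput i.*2
  | GConst b => GConst b
  | GNot a => GNot (n + a).+2
  | GAnd a b => GAnd (n + a).+2 (n + b).+2
  | GOr a b => GOr (n + a).+2 (n + b).+2
  end.

(** Gates 0 and 1 are the constants, the next [n] read the bits of [y], and those of [C] follow,
    with inputs taken from even positions. The outputs spell [0 y 1 C(x)]. Interleaving [x] with [y]
    lets [x] be extracted by [evens], which does not refer to [n]. *)
Definition mantel_circuit (C : circuit) : circuit :=
  let n := inputs C in
  Circuit n.*2
    ([:: GConst false; GConst true] ++ [seq GInput i.*2.+1 | i <- iota 0 n] ++
     map (shift_gate n) (gates C))
    ([:: 0] ++ [seq i.+2 | i <- iota 0 n] ++ [:: 1] ++
     [seq (n + o).+2 | o <- outputs C]).

(** * The transducer writes the code of [mantel_circuit] *)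

Section ScanMantel.
Notation sc := (scan mantel_step).

Lemma scan_skip m v w : sc (m, Skip) v w = ([::], (m, Skip), v).
Proof. by elim: w => //= b w ->. Qed.

Lemma enc_nat_add m n : enc_nat (m + n) = nseq m true ++ enc_nat n.
Proof. by rewrite /enc_nat nseqD rcons_cat. Qed.

Lemma scan_header n v w : sc (false, Header) v (enc_nat n ++ w) =
  (enc_nat n.*2 ++ (true :: enc_gate (GConst false)) ++ true :: enc_gate (GConst true),
   (false, Skip), v).
Proof. by elim: n => [|n IH] /=; rewrite ?scan_skip // IH. Qed.

(** At each stroke of the header counter [false] holds the current [i]; writing it twice and one
    more stroke gives [i.*2.+1]. Starting from 0 it ends at [n], the amount needed later to shift
    indices. *)
Lemma scan_ygate n a v w : sc (false, YGate) (a, v) (enc_nat n ++ w) =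
  let r := sc (false, Gate) (n + a, v) w in
  (flatten [seq true :: enc_gate (GInput i.*2.+1) | i <- iota a n] ++ r.1.1, r.1.2, r.2).
Proof.
elim: n a => [|n IH] a /=; first by case: (scan _ _ _ _) => [[]].
have E : enc_nat a.*2.+1 = nseq a true ++ nseq a true ++ [:: true; false].
  by rewrite -addnn -addn1 -addnA !enc_nat_add.
rewrite IH /= -addSnnS /count_of /=.
by rewrite -[true :: (rcons _ _ ++ _) ++ _]/((enc_nat a.*2.+1 ++ _) ++ _) E -!catA.
Qed.

(** The enumeration uses counter [true], because counter [false] must keep [n] for shifting the
    outputs of [C]. *)
Lemma scan_yout n a v w : sc (false, YOut) (v, a) (enc_nat n ++ w) =
  let r := sc (true, Gate) (v, n + a) w in
  (flatten [seq true :: enc_nat i.+2 | i <- iota a n] ++ (true :: enc_nat 1) ++ r.1.1,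
   r.1.2, r.2).
Proof.
elim: n a => [|n IH] a /=; first by case: (scan _ _ _ _) => [[]].
by rewrite IH /= -addSnnS /count_of /= -[rcons (nseq a _) _]cats1 -!catA.
Qed.

Lemma scan_input n m v w : sc (m, Input) v (enc_nat n ++ w) =
  let r := sc (m, Gate) v w in
  ((if m then [::] else enc_nat n.*2) ++ r.1.1, r.1.2, r.2).
Proof. by case: m; elim: n => [|n IH] //=; rewrite IH. Qed.

Lemma scan_idx1 n m v w : sc (m, Idx1) v (enc_nat n ++ w) =
  let r := sc (m, Gate) v w in
  ((if m then [::] else enc_nat n) ++ r.1.1, r.1.2, r.2).
Proof. by case: m; elim: n => [|n IH] //=; rewrite IH. Qed.

(** In unary, addition is prefixing strokes. The strokes that shift the second index are therefore
    written as soon as the first index ends. *)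
Lemma scan_idx2 n m v w : sc (m, Idx2) v (enc_nat n ++ w) =
  let r := sc (m, Idx1) v w in
  ((if m then [::] else enc_nat n ++ [:: true; true] ++ nseq v.1 true) ++ r.1.1,
   r.1.2, r.2).
Proof.
case: m; elim: n => [|n IH] //=; rewrite ?IH //.
by rewrite /count_of cats0.
Qed.

Lemma scan_outnum n m v w : sc (m, OutNum) v (enc_nat n ++ w) =
  let r := sc (m, Out) v w in (enc_nat n ++ r.1.1, r.1.2, r.2).
Proof. by elim: n => [|n IH] //=; rewrite IH. Qed.

Lemma scan_gate g m v w : sc (m, Gate) v (true :: enc_gate g ++ w) =
  let r := sc (m, Gate) v w in
  ((if m then [::] else true :: enc_gate (shift_gate v.1 g)) ++ r.1.1, r.1.2, r.2).
Proof.
have E n : enc_nat (v.1 + n).+2 = [:: true; true] ++ nseq v.1 true ++ enc_nat n.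
  by rewrite -addn2 addnC 2!enc_nat_add.
case: g => [i|b|a|a b|a b]; rewrite /shift_gate /enc_gate ?E /= -?catA.
- by rewrite scan_input; case: m.
- by case: m.
- by rewrite scan_idx1; case: m => //=; rewrite /count_of /= cats0 -!catA /= -?catA.
- by rewrite scan_idx2 /= scan_idx1; case: m => //=; rewrite /count_of /= cats0 -!catA /= -?catA.
- by rewrite scan_idx2 /= scan_idx1; case: m => //=; rewrite /count_of /= cats0 -!catA /= -?catA.
Qed.

Lemma enc_seq_cons T (enc : T -> bitseq) a s :
  enc_seq enc (a :: s) = true :: enc a ++ enc_seq enc s.
Proof. by rewrite /enc_seq /= rcons_cat. Qed.

Lemma scan_gates gs m v w : sc (m, Gate) v (enc_seq enc_gate gs ++ w) =
  let r := sc (m, Gate) v (false :: w) in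
  ((if m then [::] else flatten [seq true :: enc_gate (shift_gate v.1 g) | g <- gs])
     ++ r.1.1, r.1.2, r.2).
Proof.
elim: gs => [|g gs IH]; first by case: m.
rewrite enc_seq_cons cat_cons -catA scan_gate IH.
by case: m {IH} => //=; rewrite !catA.
Qed.

Lemma scan_out os m v : sc (m, Out) v (enc_seq enc_nat os) =
  (enc_seq enc_nat [seq (v.1 + o).+2 | o <- os], (m, Skip), v).
Proof.
elim: os => [//|o os IH]; rewrite map_cons !enc_seq_cons.
rewrite -[(v.1 + o).+2]add2n 2!enc_nat_add /= scan_outnum IH /=.
by rewrite /count_of /= cats0 -!catA.
Qed.

Lemma enc_seq_cat T (enc : T -> bitseq) s t :
  enc_seq enc (s ++ t) = flatten [seq true :: enc a | a <- s] ++ enc_seq enc t.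
Proof. by rewrite /enc_seq map_cat flatten_cat rcons_cat. Qed.

(** The three outputs join in the middle of lists: the first reading leaves the gate list open after
    the two constants, and the second one closes it and already writes output 0, the leading bit of
    [u]. *)
Lemma mantel_instanceE C : mantel_instance (enc_circuit C) = enc_circuit (mantel_circuit C).
Proof.
case: C => n gs os; rewrite /enc_circuit [gates _]/= [outputs _]/= !enc_seq_cat.
rewrite {1}/enc_seq -!map_comp /mantel_instance [LHS]/=.
rewrite scan_header /= scan_ygate /= addn0 scan_gates /= scan_skip /=.
rewrite scan_yout /= addn0 scan_gates /= scan_out /= !cats0.
by rewrite [enc_seq enc_gate (map _ _)]/enc_seq -map_comp -cats1 -!catA /= -?catA.
Qed.

End ScanMantel.

(** * Even and odd positions *)

Fixpoint evens (s : bitseq) : bitseq :=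
  if s is a :: s' then a :: (if s' is _ :: s'' then evens s'' else [::]) else [::].

Definition evens_step (skip b : bool) : bool * seq instr :=
  (~~ skip, if skip then [::] else [:: Emit b]).

Lemma evensE s : evens s = passes evens_step [:: false] (0, 0) s.
Proof.
rewrite /= cats0; suff : forall q v,
    (scan evens_step q v s).1.1 = evens (if q then behead s else s) by move->.
elim: s => [|a s IH] [] v //=; rewrite IH //.
by case: (s).
Qed.

Lemma polytime1_evens : polytime1 evens.
Proof.
have [k [M [T [pT h]]]] := polytime1_passes evens_step [:: false].
by exists k, M, T; split=> // x; rewrite evensE.
Qed.

Lemma nth_evens s i : nth false (evens s) i = nth false s i.*2.
Proof. by elim: i s => [|i IH] [|a [|b s]] //=; rewrite nth_nil. Qed.

Lemma size_evens n s : size s = n.*2 -> size (evens s) = n.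
Proof. by elim: n s => [|n IH] [|a [|b s]] //= [/IH ->]. Qed.

(** An even length preserves parity in [t], so [evens] turns a concatenated pair of edge indices
    into the pair of their [x] parts. *)
Lemma evens_cat n s t : size s = n.*2 -> evens (s ++ t) = evens s ++ evens t.
Proof. by elim: n s => [|n IH] [|a [|b s]] //= [/IH ->]. Qed.

Definition odds (n : nat) (s : bitseq) : bitseq :=
  [seq nth false s i.*2.+1 | i <- iota 0 n].

Lemma evens_odds_inj n s t : size s = n.*2 -> size t = n.*2 ->
  evens s = evens t -> odds n s = odds n t -> s = t.
Proof.
move=> hs ht he ho; apply: (@eq_from_nth _ false); rewrite hs ?ht // => j hj.
rewrite -(odd_double_half j); case: (odd j) => /=; last first.
  by rewrite -!nth_evens he.
have hj2 : j./2 < n by rewrite ltn_half_double.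
have := congr1 (fun u => nth false u j./2) ho.
by rewrite /odds !(nth_map 0) ?size_iota // !nth_iota.
Qed.

(** * Values and well-formedness of the new circuit *)

Lemma gate_vals_inputs x s (h : nat -> nat) acc :
  foldl (fun vals g => rcons vals (gate_val x vals g)) acc [seq GInput (h i) | i <- s] =
  acc ++ [seq nth false x (h i) | i <- s].
Proof.
by elim: s acc => [|i s IH] acc /=; rewrite ?cats0 // IH cat_rcons.
Qed.

Lemma gate_vals_mantel C x :
  gate_vals (mantel_circuit C) x =
  [:: false; true] ++ odds (inputs C) x ++ gate_vals C (evens x).
Proof.
rewrite /gate_vals /= foldl_cat (gate_vals_inputs _ _ (fun i => i.*2.+1)).
set pre := [:: _; _] ++ _; set n := inputs C.
have spre : size pre = n.+2 by rewrite /pre /= size_map size_iota.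
(* Shifted indices skip the prefix of [n.+2] values. Positions out of range read [false] on both
   sides, so the equality holds for every [a]. *)
have npre vals a : nth false (pre ++ vals) (n + a).+2 = nth false vals a.
  by rewrite nth_cat spre -!addSn ltnNge leq_addr addKn.
rewrite -[RHS]/(pre ++ _) -{1}[pre]cats0; move: pre spre npre => pre _ npre.
elim: (gates C) [::] => [|g gs IH] vals //=.
rewrite -IH -rcons_cat; congr foldl; congr rcons.
by case: g => [i|b|a|a b|a b] //=; rewrite ?npre // nth_evens.
Qed.

Lemma circuit_eval_mantel C x :
  circuit_eval (mantel_circuit C) x =
  (false :: odds (inputs C) x) ++ (true :: circuit_eval C (evens x)).
Proof.
rewrite /circuit_eval gate_vals_mantel /= map_cat /= -!map_comp.
congr (_ :: _ ++ _ :: _).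
  apply/eq_in_map => i; rewrite mem_iota add0n => /andP [_ hi] /=.
  rewrite nth_cat size_map size_iota hi (nth_map 0) ?size_iota // nth_iota //.
apply: eq_map => o /=.
by rewrite nth_cat size_map size_iota ltnNge leq_addr addKn.
Qed.

(** Vertices have [n.+1] bits, the leading one marking the side of the bipartition, so an edge index
    has exactly [2 * n] bits. *)
Lemma mantel_circuit_type n C : circuit_of_type n n C ->
  circuit_of_type (2 * n.+1 - 2) (2 * n.+1) (mantel_circuit C).
Proof.
move=> [/andP [/allP wg /allP wo] Cn sn]; split.
- apply/andP; split; apply/allP.
    move=> j; rewrite mem_iota add0n leq0n /= size_cat !size_map size_iota.
    case: j => [|[|j]] //=; rewrite !ltnS => hj.
    rewrite nth_cat size_map size_iota; case: ltnP => jn.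
      by rewrite (nth_map 0) ?size_iota // nth_iota //=; lia.
    have hG : j - inputs C < size (gates C) by lia.
    rewrite (nth_map (GConst false)) //.
    have := wg (j - inputs C); rewrite mem_iota hG => /(_ isT).
    by case: (nth _ _ _) => [i|b|a|a b|a b] //=; lia.
  move=> o; rewrite /= !size_cat !size_map size_iota inE => /predU1P [-> //|].
  rewrite mem_cat inE => /or3P [/mapP [i]|/eqP -> //|/mapP [i /wo]].
    by rewrite mem_iota => hi ->; lia.
  by move=> hi ->; lia.
- by rewrite /= Cn; lia.
- by rewrite /= size_cat /= !size_map size_iota sn Cn; lia.
Qed.

(** * From Mantel solutions to Pigeon solutions *)

Lemma bits_to_nat_cons b s : bits_to_nat (b :: s) = b * 2 ^ size s + bits_to_nat s.
Proof.
rewrite /bits_to_nat /=; have -> : 0.*2 + b = b by [].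
suff : forall a, foldl (fun (a : nat) (b : bool) => a.*2 + b) a s = a * 2 ^ size s +
  foldl (fun (a : nat) (b : bool) => a.*2 + b) 0 s by move->.
elim: s => [|c s IH] a /=; first by rewrite muln1 addn0.
by rewrite IH [in RHS]IH expnS; lia.
Qed.

Lemma bits_to_nat_lt s : bits_to_nat s < 2 ^ size s.
Proof.
elim: s => // b s IH; rewrite bits_to_nat_cons /= expnS.
by case: b; lia.
Qed.

Lemma bits_to_nat_eq0 s : bits_to_nat s = 0 -> s = nseq (size s) false.
Proof.
elim: s => // -[] s IH; rewrite bits_to_nat_cons /=.
  by have := expn_gt0 2 (size s) => /=; lia.
by rewrite mul0n add0n => /IH {1}->.
Qed.

Lemma pigeon_of_mantel n C s : circuit_of_type n n C ->
  mantel_solution n.+1 (mantel_circuit C) s -> pigeon_solution n C (evens s).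
Proof.
move=> [_ Cn sn].
have l2 : 2 * n.+1 - 2 = n.*2 by lia.
have so x : size (odds (inputs C) x) = n by rewrite size_map size_iota Cn.
have sC x : size (circuit_eval C x) = n by rewrite size_map.
have edgeE x : edge n.+1 (mantel_circuit C) x =
    (false :: odds n x, true :: circuit_eval C (evens x)).
  rewrite /edge circuit_eval_mantel take_size_cat ?drop_size_cat /= ?so //.
  by rewrite Cn.
rewrite /mantel_solution l2 => -[[i [j [k [_ _]]]]|[ss]|[i [j [es ij]]]|[ss]].
(* The leading bits of the endpoints of every edge differ, and three bits cannot be pairwise
   distinct. *)
- have heads e a b : e.1 = false :: behead e.1 -> e.2 = true :: behead e.2 ->
      joins e a b -> head false a != head false b.
    by move=> h1 h2 [] E; rewrite E /= in h1 h2; rewrite h1 h2.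
  have hi x a b : joins (edge n.+1 (mantel_circuit C) x) a b ->
      head false a != head false b by apply: heads; rewrite edgeE.
  move=> [a [b [c [_ [/hi ab /hi bc /hi ac]]]]].
  by move: ab bc ac; case: (head _ a); case: (head _ b); case: (head _ c).
- by rewrite edgeE /lex_ge /= lexi_cons.
(* Equal edges agree on [y] and on [C(x)]. Since the indices differ and their odd positions agree,
   their even positions form a collision. *)
- rewrite !edgeE => -[ho hC].
  have si := size_tuple i; have sj := size_tuple j.
  have ei : size (evens i) == n by rewrite (size_evens si).
  have ej : size (evens j) == n by rewrite (size_evens sj).
  right; exists (Tuple ei), (Tuple ej); split=> //=.
    by rewrite es (evens_cat _ si).
  move=> /(congr1 val) /= he; apply: ij; apply: val_inj.
  exact: evens_odds_inj si sj he ho.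
rewrite edgeE /= !bits_to_nat_cons mul0n mul1n add0n sC => hv.
left; split; first exact: size_evens.
have ho : bits_to_nat (odds n s) < 2 ^ n by rewrite -{2}(so s) Cn bits_to_nat_lt.
have p0 : 0 < 2 ^ n by rewrite expn_gt0.
(* As [u < 2 ^ n], the successor does not wrap around modulo [2 ^ n.+1]. Then
   [2 ^ n + C(x) = u + 1 <= 2 ^ n] forces [C(x) = 0]. *)
rewrite modn_small in hv; last by rewrite expnS; lia.
by rewrite -[in RHS](sC (evens s)); apply: bits_to_nat_eq0; lia.
Qed.

Theorem theorem8p8 : PPP_hard Mantel.
Proof.
move=> R [_ [f [g [pf pg fg]]]].
have pF : polytime1 mantel_instance by apply: polytime1_passes.
exists (mantel_instance \o f), (fun x s => g x (evens s)); split.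
- exact: polytime1_comp.
- exact: polytime2_comp polytime1_evens.
(* Unfolding [Pigeon] leaves only the case where [f x] encodes a circuit [C] of the right type; any
   other instance is solved by every string. *)
move=> x s hs; apply: fg => n C fx tC; apply: pigeon_of_mantel (tC) _.
by apply: hs => //; [rewrite /= fx mantel_instanceE | apply: mantel_circuit_type].
Qed.
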